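(* Let $t$ be a positive integer and let $G$ be a graph. If there is an oddomorphism from $G$ to $K_{\binom{t}{2}(7t+7)}$ (that is, $G$ admits a $\binom{t}{2}(7t+7)$-oddomorphism), then $G$ contains a $K_t$-immersion (that is, $G$ contains $K_t$ as an immersion).
   Context: Graphs are finite, simple (no loops, no parallel edges), undirected and have nonempty vertex set. (In particular, no graph admits a proper colouring with $0$ colours, so the hypothesis is never satisfied when $t=1$.) Let $f:V(G)\to S$ be a proper colouring of a graph $G$. A vertex $u\in V(G)$ is $f$-odd (respectively, $f$-even) if $N_G(u)$ contains an odd (respectively, even) number of vertices of each colour in $S\setminus\{f(u)\}$. A vertex may be neither $f$-odd nor $f$-even. A proper $n$-colouring $f:V(G)\to S$, $|S|=n$, is an $n$-oddomorphism, also called an oddomorphism from $G$ to $K_n$ (identifying $S$ with $V(K_n)$), if (1) every vertex of $G$ is either $f$-even or $f$-odd, and (2) for each colour in $S$, the colour class of that colour contains an odd number of $f$-odd vertices. Given three distinct vertices $u,v,w$ with edges $uv$, $vw$, to split off $uv$ and $vw$ is to delete the edges $uv$ and $vw$ and add the edge $uw$ (possibly adding a parallel edge, so intermediate graphs may be multigraphs). A graph $G$ contains a graph $H$ as an immersion if $H$ can be obtained (up to isomorphism) from a subgraph of $G$ by splitting off pairs of edges and deleting isolated vertices. Equivalently, there is an injective map $\phi:V(H)\to V(G)$ and a collection of pairwise edge-disjoint paths in $G$, one for each edge of $H$, such that the path corresponding to the edge $uv\in E(H)$ has endpoints $\phi(u)$ and $\phi(v)$. *)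

(* Defs.v *)
From mathcomp Require Import all_boot.

Set Implicit Arguments.
Unset Strict Implicit.
Unset Printing Implicit Defensive.

(* A finite simple graph is a nonempty finite vertex type with a symmetric
   and irreflexive adjacency relation. *)
Definition simple_graph (V : finType) (e : rel V) : Prop :=
  [/\ 0 < #|V|, symmetric e & irreflexive e].

Definition complete_rel (n : nat) : rel 'I_n := fun i j => i != j.

Section Oddomorphism.

Variables (V S : finType) (e : rel V) (f : V -> S).

Definition proper_colouring : Prop := forall u v, e u v -> f u != f v.

Definition colour_nbrs (u : V) (c : S) : {set V} :=
  [set v | e u v & f v == c].

Definition f_odd (u : V) : bool :=
  [forall c : S, (c != f u) ==> odd #|colour_nbrs u c|].

Definition f_even (u : V) : bool :=
  [forall c : S, (c != f u) ==> ~~ odd #|colour_nbrs u c|].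

Definition oddomorphism : Prop :=
  [/\ proper_colouring,
      forall u, f_even u \/ f_odd u
    & forall c : S, odd #|[set u | f u == c & f_odd u]|].

End Oddomorphism.

(* The colour set of an n-oddomorphism is identified with 'I_n, the vertex
   set of K_n. *)
Definition has_oddomorphism (V : finType) (e : rel V) (n : nat) : Prop :=
  exists f : V -> 'I_n, oddomorphism e f.

(* A loopless multigraph is given by its edge multiplicities, a symmetric
   function; a simple graph has multiplicities 0 and 1. *)
Definition multiplicity (V : finType) := V -> V -> nat.

Definition simple_mult (V : finType) (e : rel V) : multiplicity V :=
  fun x y => nat_of_bool (e x y).

Definition is_edge (V : finType) (u v x y : V) : bool :=
  [|| (x == u) && (y == v) | (x == v) && (y == u)].

(* As u, v, w are distinct, uv and vw are different edges, each present at
   least once, so the truncated subtractions are exact. *)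
Definition split_off (V : finType) (m m' : multiplicity V) : Prop :=
  exists u v w : V,
    [/\ uniq [:: u; v; w], 0 < m u v, 0 < m v w
      & forall x y,
          m' x y = m x y - is_edge u v x y - is_edge v w x y
                   + is_edge u w x y].

Inductive split_offs (V : finType) (m : multiplicity V) :
    multiplicity V -> Prop :=
| Split_refl : split_offs m m
| Split_step m1 m2 : split_offs m m1 -> split_off m1 m2 -> split_offs m m2.

Definition subgraph (V : finType) (W : {set V}) (e' e : rel V) : Prop :=
  [/\ symmetric e', subrel e' e
    & forall x y, e' x y -> (x \in W) && (y \in W)].

(* (V, e) contains (H, eH) as an immersion: a subgraph (W, e') of (V, e) is
   turned by split-offs into a multigraph m on W; vertices of W outside U,
   all isolated in m, are deleted; and phi is an isomorphism from (H, eH)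
   onto the multigraph induced by m on U. *)
Definition contains_immersion (V : finType) (e : rel V)
    (H : finType) (eH : rel H) : Prop :=
  exists (W : {set V}) (e' : rel V) (m : multiplicity V)
         (U : {set V}) (phi : H -> V),
    [/\ subgraph W e' e,
        split_offs (simple_mult e') m,
        U \subset W /\
          (forall x, x \in W :\: U -> forall y, m x y = 0)
      & [/\ injective phi,
            phi @: [set: H] = U
          & forall a b, m (phi a) (phi b) = simple_mult eH a b]].

(* Main.v *)
(* Let s = t - 1. Counting edges between two colours shows that a vertex set
   which fewer than n - 1 edges leave contains either an odd number of f-odd
   vertices of every colour or an even number of every colour. This parity
   singles out a set R of at least n vertices such that every set separating two
   of them is left by at least s^2 edges. By integral max-flow min-cut, s
   vertices of R can each send s edge-disjoint paths to a further vertex r of R;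
   splitting these paths off gives a star with centre r and all multiplicities
   s, from which K_t is obtained by splitting off pairs of edges at r. *)

Require Import Defs.
From mathcomp Require Import all_boot all_order all_algebra.
From mathcomp Require Import zify.

Set Implicit Arguments.
Unset Strict Implicit.
Unset Printing Implicit Defensive.

(** * Edge cuts and their uncrossing inequalities *)

Section Cut.

Variables (V : finType) (e : rel V).
Hypothesis e_sym : symmetric e.

Definition cut (X : {set V}) : nat :=
  \sum_(u in X) \sum_(v in ~: X) e u v.

(** Every edge leaving [X] is met once from each end. In this symmetric form, inequalities between
    cuts can be checked separately for each ordered pair [(u, v)]. *)
Lemma cut_double (X : {set V}) :
  \sum_u \sum_v e u v * ((u \in X) (+) (v \in X)) = 2 * cut X.
Proof.
have cutE Y : cut Y = \sum_u \sum_v e u v * ((u \in Y) && (v \notin Y)).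
  rewrite /cut big_mkcond; apply: eq_bigr => u _.
  case: (u \in Y) => /=; last by rewrite big1 // => v _; rewrite muln0.
  rewrite big_mkcond; apply: eq_bigr => v _.
  by rewrite inE; case: (v \in Y); rewrite ?muln0 ?muln1.
have cutE' : cut X = \sum_u \sum_v e u v * ((v \in X) && (u \notin X)).
  by rewrite cutE exchange_big; do 2!apply: eq_bigr => ? _; rewrite e_sym.
rewrite mul2n -addnn {1}cutE cutE' -big_split /=.
apply: eq_bigr => u _; rewrite -big_split /=; apply: eq_bigr => v _.
by case: (u \in X); case: (v \in X); case: (e u v).
Qed.

(** Posimodularity: in each of the sixteen membership patterns, an ordered pair [(u, v)] contributes
    no more on the left than on the right. *)
Lemma cut_setD (A B : {set V}) : cut (A :\: B) + cut (B :\: A) <= cut A + cut B.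
Proof.
rewrite -(@leq_pmul2l 2) // !mulnDr -!cut_double -!big_split /=.
apply: leq_sum => u _; rewrite -!big_split; apply: leq_sum => v _ /=.
rewrite !inE.
by case: (u \in A); case: (u \in B); case: (v \in A); case: (v \in B); case: (e u v).
Qed.

(** An edge leaving a part of [X] either leaves [X] or joins the two parts; in the latter case it
    crosses [Y] and is counted twice, hence the factor 2. *)
Lemma cut_setID (X Y : {set V}) :
  cut (X :&: Y) + cut (X :\: Y) <= cut X + 2 * cut Y.
Proof.
rewrite -(@leq_pmul2l 2) //.
rewrite [leqRHS](_ : _ = 2 * cut X + 2 * cut Y + 2 * cut Y); last lia.
rewrite mulnDr -!cut_double -!big_split /=.
apply: leq_sum => u _; rewrite -!big_split; apply: leq_sum => v _ /=.
rewrite !inE.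
by case: (u \in X); case: (u \in Y); case: (v \in X); case: (v \in Y); case: (e u v).
Qed.

End Cut.

(** * Parities of odd vertices by colour, and a well-linked set *)

Section Parity.

Variables (V : finType) (e : rel V) (n : nat) (f : V -> 'I_n).
Hypothesis e_sym : symmetric e.
Hypothesis f_odd_even : forall u, f_even e f u \/ f_odd e f u.

Definition odd_count (X : {set V}) (a : 'I_n) : nat :=
  \sum_(u in X) ((f u == a) && f_odd e f u).

Definition all_odd X := [forall a, odd (odd_count X a)].
Definition all_even X := [forall a, ~~ odd (odd_count X a)].

Lemma odd_count_setID X Y a :
  odd_count X a = odd_count (X :&: Y) a + odd_count (X :\: Y) a.
Proof. by rewrite /odd_count (big_setID Y). Qed.

Lemma odd_sum (I : finType) (P : pred I) (F G : I -> nat) :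
  (forall i, P i -> odd (F i) = odd (G i)) ->
  odd (\sum_(i | P i) F i) = odd (\sum_(i | P i) G i).
Proof.
move=> FG; apply: (big_ind2 (fun x y => odd x = odd y)) => //.
by move=> x1 x2 y1 y2 h1 h2; rewrite !oddD h1 h2.
Qed.

Definition colour_cut (X : {set V}) (a c : 'I_n) : nat :=
  \sum_(u in X | f u == a) \sum_(v in ~: X | f v == c) e u v.

Definition colour_inner (X : {set V}) (a c : 'I_n) : nat :=
  \sum_(u in X | f u == a) \sum_(v in X | f v == c) e u v.

Lemma colour_innerC X a c : colour_inner X a c = colour_inner X c a.
Proof.
rewrite /colour_inner exchange_big; apply: eq_bigr => u _.
by apply: eq_bigr => v _; rewrite e_sym.
Qed.

(** A vertex of colour [a] is [f_odd] exactly when its number of neighbours of colour [c] is odd.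
    Summing over [X], these neighbours are sorted into those inside and those outside [X]. *)
Lemma odd_countE X a c : a != c ->
  odd (odd_count X a) = odd (colour_inner X a c + colour_cut X a c).
Proof.
move=> ac; rewrite /odd_count.
have -> : \sum_(u in X) ((f u == a) && f_odd e f u) =
          \sum_(u in X | f u == a) f_odd e f u.
  by rewrite big_mkcondr; apply: eq_bigr => u _; case: ifP.
rewrite -big_split; apply: odd_sum => u /andP[_ /eqP fu] /=.
have -> : \sum_(v in X | f v == c) e u v + \sum_(v in ~: X | f v == c) e u v
    = #|colour_nbrs e f u c|.
  rewrite -sum1_card [RHS]big_mkcond [RHS](bigID (mem X)) /=; congr (_ + _).
    rewrite big_mkcondr /=; apply: eq_bigr => v _.
    by rewrite inE andbC; case: eqP; case: (e u v).
  rewrite big_mkcondr /=; apply: eq_big => v; first by rewrite inE.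
  by move=> _; rewrite inE andbC; case: eqP; case: (e u v).
have cf : c != f u by rewrite fu eq_sym.
case: (f_odd_even u) => h; last first.
  by rewrite h; move/forallP/(_ c): h; rewrite cf => /= ->.
have ev : odd #|colour_nbrs e f u c| = false.
  by move/forallP/(_ c): h; rewrite cf /= => /negbTE.
rewrite ev; case: (boolP (f_odd e f u)) => // /forallP/(_ c).
by rewrite cf ev.
Qed.

(** [colour_inner] is symmetric in the colours, so a difference in parity between [a] and [c] must
    come from the two cut terms, which then cannot both vanish. *)
Lemma colour_cut_gt0 X a c :
  odd (odd_count X a) -> ~~ odd (odd_count X c) ->
  0 < colour_cut X a c + colour_cut X c a.
Proof.
move=> oa oc; have ac : a != c by apply: contraNneq oc => <-.
have ca : c != a by rewrite eq_sym.
move: oa oc; rewrite (odd_countE X ac) (odd_countE X ca) colour_innerC !oddD.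
case: (colour_cut X a c) => //; case: (colour_cut X c a) => //.
by case: (odd (colour_inner _ _ _)).
Qed.

Lemma cut_colour_cut X : cut e X = \sum_a \sum_c colour_cut X a c.
Proof.
rewrite /cut (partition_big f xpredT) //=; apply: eq_bigr => a _.
rewrite [RHS]exchange_big /=; apply: eq_bigr => u _.
by rewrite (partition_big f xpredT).
Qed.

(* The pairs of colours with different parities number at least n - 1, and each
   of them contributes an edge to the cut. *)
Lemma small_cut_parity X : cut e X < n.-1 -> all_odd X \/ all_even X.
Proof.
move=> small; pose A := [set a | odd (odd_count X a)].
case: (set_0Vmem A) => [A0|[a aA]].
  right; apply/forallP => a; have := in_set0 a; rewrite -A0 inE => -> //.
case: (set_0Vmem (~: A)) => [A0|[c cA]].
  left; apply/forallP => b; have := in_set0 b; rewrite -A0 !inE => /negbFE //.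
have cardA : #|A| + #|~: A| = n by rewrite cardsC card_ord.
have A_gt0 : 0 < #|A| by apply/card_gt0P; exists a.
have A'_gt0 : 0 < #|~: A| by apply/card_gt0P; exists c.
(* Two positive integers with sum [n] have product at least [n - 1]. *)
suff : #|A| * #|~: A| <= cut e X by move: cardA A_gt0 A'_gt0 small; nia.
rewrite cut_colour_cut (bigID (mem A)) /=.
apply: leq_trans (_ : \sum_(i in A) \sum_(j in ~: A)
   (colour_cut X i j + colour_cut X j i) <= _).
  rewrite -sum_nat_const; apply: leq_sum => i iA.
  rewrite -sum1_card; apply: leq_sum => j jA.
  by apply: colour_cut_gt0; move: iA jA; rewrite !inE.
rewrite [leqLHS](eq_bigr (fun i => \sum_(j in ~: A) colour_cut X i j +
  \sum_(j in ~: A) colour_cut X j i)); last by move=> i _; rewrite big_split.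
rewrite big_split /=; apply: leq_add.
  by apply: leq_sum => i _; rewrite [leqRHS](bigID (mem (~: A))) leq_addr.
rewrite exchange_big /=.
rewrite (eq_bigl (fun i => i \notin A)); last by move=> i; rewrite inE.
by apply: leq_sum => i _; rewrite [leqRHS](bigID (mem A)) leq_addr.
Qed.

Variable k : nat.
Hypotheses (k_gt0 : 0 < k) (k_lt : k < n).
Hypothesis setT_odd : all_odd [set: V].

(* Take an inclusion-minimal X with all parities odd and fewer than k edges
   leaving it. The subsets A of X with all parities even and cut e A < k can be
   uncrossed by posimodularity, because minimality forces A :\: B to have even
   parities again. Hence their union is also a disjoint union of such sets, its
   parities are even, and R, the rest of X, meets every colour. *)
Lemma well_linked_set : exists R : {set V},
  n <= #|R| /\ forall (x y : V) (Y : {set V}),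
    x \in R -> y \in R -> x \in Y -> y \notin Y -> k < 2 * cut e Y.
Proof.
pose P X := all_odd X && (cut e X < k).
have PT : P [set: V].
  by rewrite /P setT_odd /cut setCT big1 // => u _; rewrite big_set0.
have [X /minsetP[/andP[oddX cutX] minX] _] := minset_exists PT.
have parity Y : cut e Y < k -> all_odd Y \/ all_even Y.
  by move=> h; apply: small_cut_parity; lia.
pose F := [set A : {set V} | [&& A \subset X, all_even A & cut e A < k]].
have uncross A B : A \in F -> cut e (A :\: B) <= cut e A -> A :\: B \in F.
  rewrite !inE => /and3P[AX evA cutA] le; have cutD := leq_ltn_trans le cutA.
  have DX : A :\: B \subset X by apply: subset_trans AX; apply: subsetDl.
  rewrite DX cutD andbT /=.
  have [oddD|//] := parity _ cutD.
  have DE : A :\: B = X by apply: minX; rewrite // /P oddD.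
  have AE : A = X by apply/eqP; rewrite eqEsubset AX -{1}DE subsetDl.
  move: evA oddX; rewrite AE => /forallP ev /forallP od.
  have n_gt0 : 0 < n by apply: leq_ltn_trans k_lt.
  by have := ev (Ordinal n_gt0); rewrite od.
pose isc (Q : {set {set V}}) := (Q \subset F) && (cover Q == cover F).
have iscF : isc F by rewrite /isc subxx eqxx.
(* A subfamily of [F] with the same union and least total size is disjoint: if [A] meets [B],
   replacing [A] by [A :\: B] keeps the union, since [B] stays, and lowers the weight. *)
pose wt (Q : {set {set V}}) := \sum_(B in Q) #|B|.
have [Q /andP[/subsetP QF /eqP coverQ] minQ] := arg_minnP wt iscF.
have remove A B : A \in Q -> B \in Q -> A != B -> ~~ [disjoint A & B] ->
    cut e (A :\: B) <= cut e A -> False.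
  move=> AQ BQ AB meet le.
  have : isc ((A :\: B) |: (Q :\ A)).
    apply/andP; split.
      apply/subsetP => C /setU1P[-> | /setD1P[_ /QF //]].
      by apply: uncross => //; apply: QF.
    rewrite -coverQ; apply/eqP/setP => x; apply/bigcupP/bigcupP.
      case=> C /setU1P[-> /setDP[xA _] | /setD1P[_ CQ] xC]; first by exists A.
      by exists C.
    case=> C CQ xC; have [CA|CA] := eqVneq C A; last first.
      by exists C; rewrite // !inE CA CQ orbT.
    have [xB|xB] := boolP (x \in B).
      by exists B; rewrite // !inE [B == A]eq_sym AB BQ orbT.
    by exists (A :\: B); rewrite ?inE ?eqxx // xB -CA.
  move/minQ; rewrite /wt (big_setD1 A AQ) /= leqNgt => /negP; apply.
  have cardD : #|A :\: B| < #|A|.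
    rewrite -(cardsID B A) -[leqLHS]add1n leq_add2r card_gt0 setI_eq0.
    exact: meet.
  (* If [A :\: B] is already a member, the replacement merely drops [A], which is nonempty. *)
  have [inD|notinD] := boolP (A :\: B \in Q :\ A).
    have -> : (A :\: B) |: (Q :\ A) = Q :\ A by apply/setUidPr; rewrite sub1set.
    by rewrite -[ltnLHS]add0n ltn_add2r (leq_ltn_trans _ cardD).
  by rewrite big_setU1 //= ltn_add2r.
have trivQ : trivIset Q.
  apply/trivIsetP => A B AQ BQ AB; apply: contraT => meet.
  (* By posimodularity at least one of the two differences has a cut no larger than that of the set
     it replaces. *)
  have := cut_setD e_sym A B.
  have [le _|gt] := leqP (cut e (A :\: B)) (cut e A).
    by case: (remove A B).
  move=> sum; have {}gt : cut e (B :\: A) <= cut e B by lia.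
  by case: (remove B A); rewrite // 1?eq_sym // disjoint_sym.
pose R := X :\: cover F.
have coverX : cover F \subset X.
  by apply/bigcupsP => A; rewrite inE => /and3P[].
have coverF_even a : ~~ odd (odd_count (cover F) a).
  rewrite -coverQ /odd_count big_trivIset //=.
  rewrite (@odd_sum _ _ _ (fun=> 0)) ?big1 // => B /QF.
  by rewrite inE => /and3P[_ /forallP/(_ a)/negbTE ->].
have R_odd a : odd (odd_count R a).
  have /forallP/(_ a) := oddX; rewrite (odd_count_setID _ (cover F)) oddD.
  by rewrite (setIidPr coverX) (negbTE (coverF_even a)).
exists R; split.
  (* An odd count is nonzero, so all [n] colours occur on [R]. *)
  rewrite -[n]card_ord; apply: leq_trans (leq_imset_card f R).
  apply/subset_leq_card/subsetP => a _; apply/imsetP.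
  have /exists_inP[u uR /eqP <-] : [exists u in R, f u == a]; last by exists u.
  apply: contraT => /exists_inPn none; have := R_odd a.
  by rewrite /odd_count big1 // => u /none/negbTE ->.
move=> x y Y /setDP[xX xU] /setDP[yX yU] xY yY.
(* A smaller cut would force [Z = X] by minimality if the parities are odd, or [Z \in F] if they are
   even; [z'] excludes the first and [z] the second. *)
have large (Z : {set V}) z z' : Z \subset X -> z \in Z -> z \notin cover F ->
    z' \in X -> z' \notin Z -> k <= cut e Z.
  move=> ZX zZ zU z'X z'Z; rewrite leqNgt; apply/negP => cutZ.
  have [oddZ|evZ] := parity _ cutZ.
    have ZE : Z = X by apply: minX; rewrite // /P oddZ.
    by move: z'Z; rewrite ZE z'X.
  by case/negP: zU; apply/bigcupP; exists Z; rewrite // inE ZX evZ.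
have h1 : k <= cut e (X :&: Y).
  by apply: (large _ x y); rewrite ?subsetIl // !inE ?xX ?xY // (negbTE yY) andbF.
have h2 : k <= cut e (X :\: Y).
  by apply: (large _ y x); rewrite ?subsetDl // !inE ?yX ?yY ?xY.
(* Both parts of [X] have cut at least [k] while [cut e X < k], so [2 * cut e Y] exceeds [k]. *)
have := cut_setID e_sym X Y; lia.
Qed.

End Parity.

(** * Splitting off walks into single edges *)

Section Walks.

Variable V : finType.

Lemma is_edgeC (u v x y : V) : is_edge u v x y = is_edge v u x y.
Proof. by rewrite /is_edge orbC. Qed.

Lemma is_edge_sym (u v x y : V) : is_edge u v x y = is_edge u v y x.
Proof. by rewrite /is_edge andbC orbC andbC. Qed.

Fixpoint walk_mult (x : V) (p : seq V) (u v : V) : nat :=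
  if p is y :: p' then is_edge x y u v + walk_mult y p' u v else 0.

Lemma walk_mult_sym x p u v : walk_mult x p u v = walk_mult x p v u.
Proof. by elim: p x => //= y p IH x; rewrite IH is_edge_sym. Qed.

Lemma split_offs_trans (m1 m2 m3 : multiplicity V) :
  split_offs m1 m2 -> split_offs m2 m3 -> split_offs m1 m3.
Proof. by move=> m12; elim=> // m m' _ IH; apply: Split_step. Qed.

(** Splitting off the first two edges shortens the walk by one; its vertices being distinct, the
    three involved are too. [rest] carries the edges outside the walk. *)
Lemma split_walk (m rest : multiplicity V) x p :
  uniq (x :: p) -> p != [::] ->
  (forall u v, m u v = rest u v + walk_mult x p u v) ->
  exists2 m', split_offs m m' &
    forall u v, m' u v = rest u v + is_edge x (last x p) u v.
Proof.
case: p => // y p + _; elim: p y m => [|z p IH] y m Ux mE.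
  by exists m => [|u v]; [apply: Split_refl | rewrite mE /= addn0].
have Uxyz : uniq [:: x; y; z].
  by move: Ux => /=; rewrite !inE !negb_or -!andbA => /and5P[-> -> _ ->].
pose m1 u v := rest u v + (is_edge x z u v + walk_mult z p u v).
have [|//|m' m1m' m'E] := IH z m1.
  by move: Ux => /=; rewrite !inE !negb_or -!andbA => /and5P[_ -> -> _ /andP[_ ->]].
exists m' => //; apply: split_offs_trans m1m'.
apply: Split_step (Split_refl _) _; exists x, y, z; split => //.
- by rewrite mE /= /is_edge !eqxx /=; lia.
- by rewrite mE /= /is_edge !eqxx /=; lia.
- move=> u v; rewrite mE /m1 /=; lia.
Qed.

Lemma split_walks (m rest : multiplicity V) (L : seq (V * seq V)) :
  all (fun q => uniq (q.1 :: q.2) && (q.2 != [::])) L ->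
  (forall u v, m u v = rest u v + \sum_(q <- L) walk_mult q.1 q.2 u v) ->
  exists2 m', split_offs m m' & forall u v,
    m' u v = rest u v + \sum_(q <- L) is_edge q.1 (last q.1 q.2) u v.
Proof.
elim: L m rest => [|[x p] L IH] m rest /=.
  by move=> _ mE; exists m => [|u v]; [apply: Split_refl | rewrite mE !big_nil].
case/andP=> /andP[Ux p0] UL mE.
pose rest1 u v := rest u v + \sum_(q <- L) walk_mult q.1 q.2 u v.
have [|m1 mm1 m1E] := @split_walk m rest1 x p Ux p0.
  by move=> u v; rewrite mE big_cons /rest1 /=; lia.
have [|m' m1m' m'E] := IH m1 (fun u v => rest u v + is_edge x (last x p) u v) UL.
  by move=> u v; rewrite m1E addnAC.
exists m' => [|u v]; first exact: split_offs_trans m1m'.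
by rewrite m'E big_cons /= addnA.
Qed.

End Walks.

(** * Integral flows and their decomposition into paths *)

Section Flow.

Import GRing.Theory Num.Theory Order.TTheory.
Local Open Scope ring_scope.

Variable V : finType.

Definition arc (x y u v : V) : int :=
  ((u == x) && (v == y))%:Z - ((u == y) && (v == x))%:Z.

Fixpoint route (x : V) (p : seq V) (u v : V) : int :=
  if p is y :: p' then arc x y u v + route y p' u v else 0.

(** Flows are antisymmetric integer functions, so a row sum is already the net outflow. *)
Definition excess (g : V -> V -> int) (u : V) : int := \sum_v g u v.

Lemma route_antisym x p u v : route x p u v = - route x p v u.
Proof. by elim: p x => [|y p IH] x //=; rewrite IH /arc !(andbC (v == _)); lia. Qed.

Lemma Posz_sum (I : finType) (P : pred I) (F : I -> nat) :
  (\sum_(i | P i) F i)%N%:Z = \sum_(i | P i) (F i)%:Z.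
Proof. exact: (big_morph Posz PoszD). Qed.

Lemma sum_indicator (b : bool) (y : V) : \sum_v (b && (v == y))%:Z = b%:Z :> int.
Proof.
rewrite (bigD1 y) //= eqxx andbT big1 ?addr0 // => v /negbTE ->.
by rewrite andbF.
Qed.

Lemma excess_route x p u : excess (route x p) u = (u == x)%:Z - (u == last x p)%:Z.
Proof.
rewrite /excess; elim: p x => [|y p IH] x /=; first by rewrite big1 // subrr.
rewrite big_split /= IH /arc sumrB !sum_indicator; lia.
Qed.

Lemma route_notin x p u v : (u \notin x :: p) || (v \notin x :: p) ->
  route x p u v = 0 /\ walk_mult x p u v = 0%N.
Proof.
elim: p x => [|y p IH] x //= h.
have [|-> ->] := IH y; first by move: h; rewrite !inE !negb_or; lia.
move: h; rewrite /arc /is_edge !inE !negb_or.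
by case/orP=> /and3P[/negbTE -> /negbTE -> _]; rewrite ?andbF.
Qed.

(** A simple path uses each edge at most once, so [walk_mult] is the absolute value of [route], and
    the sign tells which of the two arcs belongs to [D]. *)
Lemma route_uniq (D : rel V) x p u v : uniq (x :: p) -> path D x p ->
  [\/ route x p u v = 0 /\ walk_mult x p u v = 0%N,
      [/\ route x p u v = 1, walk_mult x p u v = 1%N & D u v]
    | [/\ route x p u v = -1, walk_mult x p u v = 1%N & D v u]].
Proof.
elim: p x => [|y p IH] x; first by constructor 1.
rewrite [uniq _]/= [path _ _ _]/= => /andP[xyp Uyp] /andP[Dxy Dp].
have xy : x != y by move: xyp; rewrite inE negb_or => /andP[].
have [/andP[/eqP ux /eqP vy]|h1] := boolP ((u == x) && (v == y)).
  have [|/= -> ->] := @route_notin y p u v; first by rewrite ux xyp.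
  constructor 2; subst; rewrite /arc /is_edge !eqxx (negbTE xy).
  by rewrite eq_sym (negbTE xy).
have [/andP[/eqP uy /eqP vx]|h2] := boolP ((u == y) && (v == x)).
  have [|/= -> ->] := @route_notin y p u v; first by rewrite vx xyp orbT.
  constructor 3; subst; rewrite /arc /is_edge !eqxx (negbTE xy).
  by rewrite eq_sym (negbTE xy).
have -> : route x (y :: p) u v = route y p u v.
  by rewrite /= /arc (negbTE h1) (negbTE h2) subrr add0r.
have -> : walk_mult x (y :: p) u v = walk_mult y p u v.
  by rewrite /= /is_edge (negbTE h1) (negbTE h2).
exact: IH.
Qed.

Definition antisym (g : V -> V -> int) := forall u v, g u v = - g v u.

(** The flow inside [Z] equals its own negative after exchanging the sums, hence cancels. *)
Lemma sum_excess g (Z : {set V}) : antisym g ->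
  \sum_(u in Z) excess g u = \sum_(u in Z) \sum_(v in ~: Z) g u v.
Proof.
move=> anti; have inner : \sum_(u in Z) \sum_(v in Z) g u v = 0.
  set S := LHS; have : S = - S.
    rewrite {1}/S exchange_big -sumrN; apply: eq_bigr => u _.
    by rewrite -sumrN; apply: eq_bigr => v _.
  lia.
transitivity (\sum_(u in Z) (\sum_(v in Z) g u v + \sum_(v in ~: Z) g u v)); last first.
  by rewrite big_split /= inner add0r.
apply: eq_bigr => u _.
rewrite /excess (bigID (mem Z)) /=; congr (_ + _).
by apply: eq_bigl => v; rewrite inE.
Qed.

Lemma excess_sub g h u : excess (fun x y => g x y - h x y) u = excess g u - excess h u.
Proof. by rewrite /excess sumrB. Qed.

Lemma excess_add g h u : excess (fun x y => g x y + h x y) u = excess g u + excess h u.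
Proof. by rewrite /excess big_split. Qed.

Lemma connect_uniq_path (D : rel V) x y : connect D x y ->
  exists p, [/\ path D x p, uniq (x :: p) & y = last x p].
Proof.
case/connectP=> p Dp ->; case/shortenP: Dp => q Dq Uq _.
by exists q.
Qed.

(** Removes one unit of supply at some source [s], for the inductions on total supply below. *)
Lemma sum_succ (r : V) (b : V -> nat) N : (\sum_(v | v != r) b v = N.+1)%N ->
  exists s b', [/\ s != r, forall v, b v = (b' v + (v == s))%N
    & (\sum_(v | v != r) b' v = N)%N].
Proof.
move=> eqN; have [s sr bs] : exists2 s, s != r & (0 < b s)%N.
  have : (0 < \sum_(v | v != r) b v)%N by rewrite eqN.
  by rewrite lt0n sum_nat_eq0 => /forall_inPn[s sr]; rewrite -lt0n; exists s.
pose b' v := (b v - (v == s))%N.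
have bE v : b v = (b' v + (v == s))%N.
  by rewrite /b'; case: eqP => [->|_]; lia.
exists s, b'; split=> //; apply: succn_inj; rewrite -eqN [RHS](bigD1 s) //=.
rewrite (bigD1 s) //= bE eqxx addn1 addSn; congr (_ + _).+1.
by apply: eq_bigr => v /andP[_ /negbTE vs]; rewrite bE vs addn0.
Qed.

(* The vertices reachable from s along arcs of positive flow have nonpositive
   total excess, hence include r. *)
Lemma flow_paths g (r : V) (b : V -> nat) : antisym g ->
  (forall v, v != r -> excess g v = (b v)%:Z) ->
  exists L : seq (V * seq V),
  [/\ all (fun q => [&& uniq (q.1 :: q.2), q.2 != [::] & last q.1 q.2 == r]) L,
      (forall F : V -> nat,
         \sum_(q <- L) F q.1 = \sum_(v | v != r) b v * F v)%N
    & forall u v, (\sum_(q <- L) walk_mult q.1 q.2 u v <= `|g u v|)%N].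
Proof.
move eqN: (\sum_(v | v != r) b v)%N => N.
elim: N g b eqN => [|N IH] g b eqN anti exg.
  exists [::]; split=> // [F|u v]; rewrite big_nil // big1 // => v vr.
  by move/eqP: eqN; rewrite sum_nat_eq0 => /forall_inP/(_ v vr)/eqP ->.
have [s [b' [sr bE sumb']]] := sum_succ eqN.
pose D := [rel u v | 0 < g u v].
have /connect_uniq_path[p [Dp Up rE]] : connect D s r.
  apply: contraT => nr; pose Z := [set v | connect D s v].
  have rZ : r \notin Z by rewrite inE.
  have sZ : s \in Z by rewrite inE connect0.
  have := sum_excess Z anti; rewrite (big_setD1 s) //= exg // => sumZ.
  have b_gt0 : 0 < (b s)%:Z by rewrite bE eqxx; lia.
  have pos : 0 <= \sum_(v in Z :\ s) excess g v.
    apply: sumr_ge0 => v /setD1P[_ vZ]; rewrite exg //.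
    by apply: contraNneq rZ => <-.
  have : \sum_(u in Z) \sum_(v in ~: Z) g u v <= 0.
    apply: sumr_le0 => u uZ; apply: sumr_le0 => v.
    rewrite inE => vZ; rewrite leNgt; apply: contra vZ => guv.
    move: uZ; rewrite !inE => su; apply: connect_trans su _.
    exact: connect1.
  by rewrite -sumZ leNgt ltr_wpDr.
pose g' u v := g u v - route s p u v.
have anti' : antisym g'.
  by move=> u v; rewrite /g' anti (route_antisym s p u); lia.
have exg' v : v != r -> excess g' v = (b' v)%:Z.
  by move=> vr; rewrite excess_sub excess_route -rE (negbTE vr) exg // bE; lia.
have [L [UL hL mL]] := IH g' b' sumb' anti' exg'.
exists ((s, p) :: L); split.
- rewrite /= UL andbT -rE eqxx andbT.
  apply/andP; split; first exact: Up.
  by apply: contraNneq sr => p0; rewrite rE p0.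
- move=> F; rewrite big_cons hL /=.
  rewrite [RHS](eq_bigr (fun v => b' v * F v + (v == s) * F v)%N); last first.
    by move=> v _; rewrite bE mulnDl.
  rewrite big_split /= addnC; congr addn.
  rewrite (bigD1 s sr) /= eqxx mul1n big1 ?addn0 // => v /andP[_ /negbTE ->].
  by rewrite mul0n.
(* The path follows arcs of positive flow, so subtracting it lowers the absolute value of [g] by
   exactly its [walk_mult]. *)
- move=> u v; rewrite big_cons /=; have := mL u v; rewrite /g'.
  have := anti u v.
  by have [[-> ->]|[-> -> /=]|[-> -> /=]] := route_uniq u v Up Dp; lia.
Qed.

Variable e : rel V.
Hypothesis e_sym : symmetric e.

(* Augmenting along a residual path; if r is not residually reachable from s,
   the reachable set is a saturated cut. *)
Lemma flow_exists (r : V) (b : V -> nat) :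
  (forall Z : {set V}, r \notin Z -> (\sum_(v in Z) b v <= cut e Z)%N) ->
  exists g, [/\ antisym g, forall u v, g u v <= (e u v)%:Z
    & forall v, v != r -> excess g v = (b v)%:Z].
Proof.
move eqN: (\sum_(v | v != r) b v)%N => N.
elim: N b eqN => [|N IH] b eqN cutb.
  exists (fun _ _ => 0); split=> // v vr; rewrite /excess big1 //.
  by move/eqP: eqN; rewrite sum_nat_eq0 => /forall_inP/(_ v vr)/eqP ->.
have [s [b' [sr bE sumb']]] := sum_succ eqN.
have [|g [anti cap exg]] := IH b' sumb'.
  move=> Z /cutb; apply: leq_trans; apply: leq_sum => v _.
  by rewrite bE leq_addr.
pose D := [rel u v | g u v < (e u v)%:Z].
have /connect_uniq_path[p [Dp Up rE]] : connect D s r.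
  apply: contraT => nr; pose Z := [set v | connect D s v].
  have rZ : r \notin Z by rewrite inE.
  have sZ : s \in Z by rewrite inE connect0.
  have := sum_excess Z anti.
  have -> : \sum_(u in Z) \sum_(v in ~: Z) g u v = (cut e Z)%:Z.
    rewrite /cut Posz_sum; apply: eq_bigr => u uZ.
    rewrite Posz_sum; apply: eq_bigr => v;rewrite inE => vZ.
    apply/eqP; rewrite eq_le cap leNgt; apply: contra vZ => guv.
    move: uZ; rewrite !inE => su; apply: connect_trans su _.
    exact: connect1.
  have -> : \sum_(u in Z) excess g u = (\sum_(u in Z) b' u)%N%:Z.
    rewrite Posz_sum; apply: eq_bigr => u uZ; rewrite exg //.
    by apply: contraNneq rZ => <-.
  (* The cut is filled by the supply [b'] of [Z], yet [b] asks for one unit more at [s]. *)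
  have := cutb Z rZ;rewrite (big_setD1 s) //=;rewrite bE eqxx;
  have -> : (\sum_(v in Z :\ s) b v = \sum_(v in Z :\ s) b' v)%N.
    by apply: eq_bigr => v /setD1P[/negbTE vs _]; rewrite bE vs addn0.
  rewrite [X in Posz X](big_setD1 s) //= => le [eq]; move: le.
  by rewrite -eq addn1 addSn ltnn.
exists (fun u v => g u v + route s p u v); split.
- by move=> u v; rewrite anti (route_antisym s p u); lia.
- move=> u v; have := cap u v; have := cap v u; have := anti u v.
  rewrite (e_sym v).
  by have [[-> _]|[-> _ /=]|[-> _ /=]] := route_uniq u v Up Dp; lia.
- move=> v vr; rewrite excess_add excess_route -rE (negbTE vr) exg // bE; lia.
Qed.

End Flow.

(** * From cut conditions to a star, and from the star to a complete graph *)

Section StarLinkage.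

Variables (V : finType) (e : rel V).
Hypothesis e_sym : symmetric e.

(** Each index lies in exactly [s] pairs; thus a star with all multiplicities [s] is a union of one
    two-edge walk per pair. *)
Lemma sum_pairs s (E : 'I_s.+1 -> nat) :
  \sum_(q : 'I_s.+1 * 'I_s.+1 | q.1 < q.2) (E q.1 + E q.2) = s * \sum_i E i.
Proof.
rewrite -(pair_big_dep xpredT (fun i j : 'I_s.+1 => i < j) (fun i j => E i + E j)) /=.
under eq_bigr do rewrite big_split /=.
rewrite big_split /= [X in _ + X](exchange_big_dep xpredT) //= -big_split big_distrr /=.
apply: eq_bigr => i _; rewrite !sum_nat_const -mulnDl; congr (_ * _).
transitivity #|predC1 i|; last by rewrite cardC1 card_ord.
rewrite -cardUI [X in _ + X](_ : _ = 0) ?addn0; last first.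
  by apply: eq_card0 => j; rewrite !inE; lia.
by apply: eq_card => j; rewrite !inE -val_eqE /=; lia.
Qed.

(* The s units of flow from each leaf to the centre phi 0 split off to a star of
   multiplicity s, which in turn splits off to a complete graph. *)
Lemma immersion_of_cuts s (phi : 'I_s.+1 -> V) : injective phi ->
  (forall (Z : {set V}) i, phi ord0 \notin Z -> phi i \in Z -> s * s <= cut e Z) ->
  contains_immersion e (@complete_rel s.+1).
Proof.
move=> phi_inj cutP; pose r := phi ord0.
pose T := phi @: [set~ ord0]; pose b v := s * (v \in T).
have cardT : #|T| = s by rewrite card_imset // cardsC1 card_ord.
have [|g [anti cap exg]] := flow_exists e_sym (r := r) (b := b).
  (* A set [Z] without leaves supplies nothing; any other supplies at most [s * s], as there are
     only [s] leaves. *)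
  move=> Z rZ; rewrite /b -big_distrr /=.
  have [disj|/pred0Pn[v /andP[/= vZ /imsetP[i _ vE]]]] := boolP [disjoint Z & T].
    by rewrite big1 ?muln0 // => v /(disjointFr disj) ->.
  apply: leq_trans (cutP Z i rZ _); last by rewrite -vE.
  rewrite leq_mul2l -[leqRHS]cardT -sum1_card !(big_mkcond [in _]) orbC.
  by apply/orP; left; apply: leq_sum => w _; case: (w \in Z); case: (w \in T).
have [L [UL hL mL]] := flow_paths anti exg.
pose M u v := \sum_(q <- L) walk_mult q.1 q.2 u v.
have M_sym u v : M u v = M v u by apply: eq_bigr => q _; rewrite walk_mult_sym.
(* The capacity holds in both directions, so it bounds the absolute value of [g]; hence the paths
   are edge-disjoint. *)
have Me u v : M u v <= e u v.
  apply: leq_trans (mL u v) _; have := cap u v; have := cap v u.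
  by rewrite (anti v u) (e_sym v); lia.
pose e' := [rel u v | 0 < M u v].
have e'M u v : simple_mult e' u v = M u v.
  by rewrite /simple_mult /=; have := Me u v; case: (e u v); case: (M u v) => [|[]].
(* The centre itself gets value 0, so that no loop at [r] is counted. *)
pose E x y (i : 'I_s.+1) : nat := if i == ord0 then 0 else is_edge (phi i) r x y.
have [|//|m1 em1 m1E] := @split_walks V (simple_mult e') (fun _ _ => 0) L.
  by apply: sub_all UL => q /and3P[-> ->].
have {}m1E x y : m1 x y = s * \sum_i E x y i.
  rewrite m1E add0n big_seq.
  rewrite (eq_bigr (fun q => nat_of_bool (is_edge q.1 r x y))); last first.
    by move=> q /(allP UL)/and3P[_ _ /eqP ->].
  (* Every path ends at [r], so the resulting edges are counted by their start vertices alone. *)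
  rewrite -big_seq (hL (fun v => nat_of_bool (is_edge v r x y))) /b.
  under eq_bigr do rewrite -mulnA.
  rewrite -big_distrr /=; congr (_ * _).
  rewrite [RHS](eq_bigr
    (fun i => (i \in [set~ ord0]) * is_edge (phi i) r x y)); last first.
    by move=> i _; rewrite /E !inE; case: eqP => _; rewrite ?mul1n.
  transitivity (\sum_(v in T) is_edge v r x y).
    rewrite big_mkcond [RHS]big_mkcond; apply: eq_bigr => v _.
    have [/imsetP[i i0 ->]|_] := boolP (v \in T); last by case: ifP.
    by rewrite mul1n inj_eq //; move: i0; rewrite !inE => ->.
  rewrite big_imset /=; last by move=> i j _ _ /phi_inj.
  by rewrite big_mkcond; apply: eq_bigr => i _; case: (i \in _); rewrite ?mul1n.
pose A := [pred q : 'I_s.+1 * 'I_s.+1 | q.1 < q.2].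
(* A pair of leaves is joined through [r]; a pair containing the centre already has its edge, a walk
   of length one that needs no splitting. *)
pose w (q : 'I_s.+1 * 'I_s.+1) :=
  if q.1 == ord0 then (r, [:: phi q.2]) else (phi q.1, [:: r; phi q.2]).
have A_neq q : q \in A -> (q.1 != q.2) * (q.2 != ord0).
  by rewrite -!val_eqE !inE /= => lt; split; lia.
have [| |m2 m12 m2E] := @split_walks V m1 (fun _ _ => 0) (map w (enum A)).
- apply/allP => _ /mapP[q qA ->]; move: qA; rewrite mem_enum => /A_neq q12.
  rewrite /w /r; case: eqP => [_|/eqP q0] /=; rewrite !inE ?negb_or !inj_eq //.
    by rewrite eq_sym q12.
  by rewrite q0 [ord0 == _]eq_sym !q12.
- move=> x y; rewrite m1E -sum_pairs big_map big_enum; apply: eq_bigr => q.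
  move=> /A_neq q12; rewrite /w /E (negbTE q12.2).
  by case: eqP => _ /=; rewrite addn0 [is_edge (phi q.2) _ _ _]is_edgeC.
have {}m2E x y : m2 x y = \sum_(q in A) is_edge (phi q.1) (phi q.2) x y.
  rewrite m2E big_map big_enum; apply: eq_bigr => q _.
  by rewrite /w; case: eqP => [->|].
exists [set: V], e', m2, (phi @: [set: 'I_s.+1]), phi; split.
- split=> [u v|u v|u v _] /=; [by rewrite M_sym| |by rewrite !inE].
  by have := Me u v; case: (e u v) => //; rewrite leqn0 => /eqP ->.
- exact: split_offs_trans em1 m12.
- split=> [|x]; first exact: subsetT.
  rewrite inE => /andP[xU _] y; rewrite m2E big1 // => q _.
  have x_phi i : (x == phi i) = false.
    by apply: contraNF xU => /eqP ->; apply: imset_f.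
  by rewrite /is_edge !x_phi.
split=> // a c; rewrite m2E /simple_mult /complete_rel.
under eq_bigr do rewrite /is_edge !inj_eq //.
have [->|ac] := eqVneq a c.
  rewrite big1 // => -[i j] /A_neq[/= ij _].
  case: eqP => [ci|_]; case: eqP => [cj|_] //.
  by rewrite -ci -cj eqxx in ij.
(* The only increasing pair made of [a] and [c]. *)
pose q0 := if a < c then (a, c) else (c, a).
rewrite (bigD1 q0) /=; last first.
  by rewrite inE /q0; case: (ltngtP a c) => //= /ord_inj/eqP; rewrite (negbTE ac).
rewrite big1 /q0 => [|[i j] /andP[]]; last first.
  rewrite inE /= => ij; apply: contraNeq; rewrite eqb0 negbK.
  case/orP=> /andP[/eqP -> /eqP ->]; first by rewrite ij.
  by rewrite ltnNge ltnW.
by case: ltnP => _ /=; rewrite !eqxx ?orbT.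
Qed.

End StarLinkage.

(** * Choice of the parameters and of the branch vertices *)

Theorem theorem1p8 (t : nat) (V : finType) (e : rel V)
  (t_gt0 : 0 < t) (G_graph : simple_graph e)
  (G_odd : has_oddomorphism e ('C(t, 2) * (7 * t + 7))) :
  contains_immersion e (@complete_rel t).
Proof.
case: G_graph => /card_gt0P[v0 _] e_sym _.
(* For [t = 1] the binomial vanishes and [v0] has no possible colour. *)
case: t t_gt0 G_odd => [//|[|s]] _ [f [_ f_odd_even f_odd_class]].
  by case: (f v0).
set n := _ * _ in f f_odd_even f_odd_class.
(* The well-linked set is used with [k] twice the square of [t - 1], since it bounds only twice the
   cut. The estimate [t - 1 <= C] for the binomial suffices. *)
have [lt_n le_n] : 2 * (s.+1 * s.+1) < n /\ s.+2 <= n.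
  have := mul_bin_diag s.+2 1; rewrite bin1 /n; move: 'C(_, _) => C /= CE.
  have : s.+1 <= C by nia.
  by split; nia.
have setT_odd : all_odd e f [set: V].
  apply/forallP => a; have := f_odd_class a.
  rewrite -sum1_card /odd_count big_mkcond /= => sum_odd.
  rewrite (_ : \sum_(u in _) _ = \sum_u
    if u \in [set u | f u == a & f_odd e f u] then 1 else 0) //.
  apply: eq_big => u; first by rewrite inE.
  by rewrite inE; case: (_ && _).
have [//|R [cardR cutR]] := well_linked_set e_sym f_odd_even _ lt_n setT_odd.
have sR : s.+2 <= #|R| := leq_trans le_n cardR.
pose phi (i : 'I_s.+2) : V := enum_val (widen_ord sR i).
have phiR i : phi i \in R := enum_valP _.
apply: (immersion_of_cuts e_sym (phi := phi)) => [i j|Z i rZ iZ].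
  by move/enum_val_inj/(congr1 val) => /= /val_inj.
by have := cutR _ _ _ (phiR i) (phiR ord0) iZ rZ; lia.
Qed.
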